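(* Let $G=(V,E)$ be a locally finite and connected graph with symmetric weight and uniformly positive measure, and let $2\le p<\infty$. Assume that $a:V\to[0,+\infty)$ satisfies: $(A_1)$ $a(x)\ge 0$ and the potential well $\Omega=\{x\in V: a(x)=0\}$ is a non-empty, connected and bounded domain in $V$; $(A_2)$ there exists a vertex $x_0\in V$ such that $a(x)\to+\infty$ as $d(x,x_0)\to+\infty$. Then for any constant $\lambda>1$ there exists a ground state solution $u_\lambda$ of the equation $$-\Delta u+(\lambda a(x)+1)u=|u|^{p-1}u\quad\text{in } V.$$
   Context: A graph $G=(V,E)$ is locally finite if each $x\in V$ has only finitely many $y\in V$ with $xy\in E$; it is connected if any two vertices can be joined by finitely many edges. Each edge $xy\in E$ has a weight $w_{xy}>0$, symmetric if $w_{xy}=w_{yx}$. The measure $\mu:V\to(0,\infty)$ is uniformly positive if there is $\mu_{\min}>0$ with $\mu(x)\ge\mu_{\min}$ for all $x\in V$. The distance $d(x,y)$ is the minimal number of edges connecting $x$ and $y$. A domain is a subset of $V$; it is bounded if $d(x,y)$ is uniformly bounded above for $x,y$ in it. Write $y\sim x$ if $xy\in E$. For functions $u,v:V\to\mathbb{R}$: $$\Delta u(x)=\frac1{\mu(x)}\sum_{y\sim x}w_{xy}(u(y)-u(x)),\quad \Gamma(u,v)(x)=\frac1{2\mu(x)}\sum_{y\sim x}w_{xy}(u(y)-u(x))(v(y)-v(x)),\quad |\nabla u|^2=\Gamma(u,u),$$ and $\int_V u\,d\mu=\sum_{x\in V}\mu(x)u(x)$. $C_c(V)$ is the set of functions on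 $V$ with finite (compact) support, and $W^{1,2}(V)$ is its completion under $\|u\|_{W^{1,2}(V)}=\left(\int_V(|\nabla u|^2+u^2)\,d\mu\right)^{1/2}$. Set $E_\lambda=\{u\in W^{1,2}(V):\int_V\lambda a u^2d\mu<+\infty\}$ with norm $\|u\|_{E_\lambda}=\left(\int_V(|\nabla u|^2+(\lambda a+1)u^2)\,d\mu\right)^{1/2}$. Let $J_\lambda(u)=\frac12\|u\|_{E_\lambda}^2-\frac1{p+1}\int_V|u|^{p+1}d\mu$ on $E_\lambda$, $\mathcal{N}_\lambda=\{u\in E_\lambda\setminus\{0\}:\|u\|_{E_\lambda}^2=\int_V|u|^{p+1}d\mu\}$ and $m_\lambda=\inf_{u\in\mathcal{N}_\lambda}J_\lambda(u)$. A weak solution of the equation is $u\in E_\lambda$ with $\int_V(\Gamma(u,\varphi)+(\lambda a+1)u\varphi)\,d\mu=\int_V|u|^{p-1}u\varphi\,d\mu$ for all $\varphi\in C_c(V)$. A ground state solution is a weak solution $u_\lambda\in\mathcal{N}_\lambda$ with $J_\lambda(u_\lambda)=m_\lambda$. *)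

(* Defs.v *)
From mathcomp Require Import all_boot all_order all_algebra.
From mathcomp Require Import all_classical all_reals all_analysis.
Set Implicit Arguments.
Unset Strict Implicit.
Unset Printing Implicit Defensive.
Import Order.TTheory GRing.Theory Num.Theory.
Import numFieldNormedType.Exports.
Local Open Scope classical_set_scope.
Local Open Scope ring_scope.

(* [weight x y] is only meaningful when [edge x y] holds. *)
Record wgraph (R : realType) (V : choiceType) := WGraph {
  edge : rel V;
  edge_sym : symmetric edge;
  weight : V -> V -> R;
  weight_gt0 : forall x y, edge x y -> 0 < weight x y;
  meas : V -> R;
  meas_gt0 : forall x, 0 < meas x }.

Section Graph.
Context {R : realType} {V : choiceType} (G : wgraph R V).
Implicit Types (x y : V) (D : set V).

Definition locally_finite := forall x, finite_set [set y | edge G x y].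

(* [path (edge G) x s] says that [x :: s] is a walk, so [size s] counts its
   edges. *)
Definition connected_graph :=
  forall x y, exists2 s : seq V, path (edge G) x s & last x s = y.

Definition symmetric_weight :=
  forall x y, edge G x y -> weight G x y = weight G y x.

Definition uniformly_positive :=
  exists2 mu_min : R, 0 < mu_min & forall x, mu_min <= meas G x.

Definition joined_in x y (n : nat) :=
  exists s : seq V, [/\ path (edge G) x s, last x s = y & size s = n].

(* The default value 0 is only taken when [x] and [y] are not joined by any
   walk. *)
Definition dist x y : nat :=
  xget 0%N [set n | joined_in x y n /\
                    forall m, joined_in x y m -> (n <= m)%N].

Definition connected_domain D :=
  forall x y, D x -> D y ->
    exists s : seq V,
      [/\ path (edge G) x s, last x s = y & forall z, z \in s -> D z].

Definition bounded_domain D :=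
  exists C : nat, forall x y, D x -> D y -> (dist x y <= C)%N.

(* The sum over [y ~ x] is a genuine finite sum when [G] is locally finite. *)
Definition Gamma (u v : V -> R) x : R :=
  (2 * meas G x)^-1 *
  \sum_(y \in [set y | edge G x y])
     weight G x y * (u y - u x) * (v y - v x).

Definition grad2 (u : V -> R) : V -> R := Gamma u u.

(* [\esum] is meant for nonnegative families, hence the splitting into positive
   and negative parts. *)
Definition integralV (u : V -> R) : \bar R :=
  let f := fun x => (meas G x * u x)%:E in
  (\esum_(x in setT) (f^\+ x) - \esum_(x in setT) (f^\- x))%E.

Definition Cc : set (V -> R) := [set u | finite_set [set x | u x != 0]].

Definition W12_norm (u : V -> R) : \bar R :=
  (integralV (fun x => grad2 u x + u x ^+ 2)%R `^ 2^-1)%E.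

(* The completion of [Cc]: since the measure is uniformly positive, convergence
   in [W12_norm] implies pointwise convergence and the completion is realized as
   the closure of [Cc] for [W12_norm] among all functions on [V]. It may be
   smaller than the set of all functions of finite norm. *)
Definition W12 : set (V -> R) :=
  [set u | exists2 phi : nat -> V -> R, (forall n, Cc (phi n)) &
     W12_norm (phi n \- u) @[n --> \oo] --> (0 : \bar R)%E].

Section Equation.
Variables (a : V -> R) (lambda p : R).

Definition E_space : set (V -> R) :=
  [set u | W12 u /\ (integralV (fun x => lambda * a x * u x ^+ 2)%R < +oo)%E].

Definition E_norm (u : V -> R) : \bar R :=
  (integralV (fun x => grad2 u x + (lambda * a x + 1) * u x ^+ 2)%R `^ 2^-1)%E.

(* On [E_space] both terms are finite when the measure is uniformly positive and
   [1 <= p]. *)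
Definition J (u : V -> R) : \bar R :=
  (2^-1%:E * E_norm u ^+ 2
   - (p + 1)^-1%:E * integralV (fun x => `|u x| `^ (p + 1))%R)%E.

Definition Nehari : set (V -> R) :=
  [set u | [/\ E_space u, u != cst 0 &
     (E_norm u ^+ 2)%E = integralV (fun x => `|u x| `^ (p + 1))]].

Definition ground_level : \bar R := ereal_inf [set J u | u in Nehari].

(* Weak solutions of - Delta u + (lambda a + 1) u = |u|^(p-1) u; both
   integrands have finite support when [G] is locally finite. *)
Definition weak_solution (u : V -> R) :=
  E_space u /\
  forall phi, Cc phi ->
    integralV (fun x => Gamma u phi x + (lambda * a x + 1) * u x * phi x) =
    integralV (fun x => `|u x| `^ (p - 1) * u x * phi x).

Definition ground_state (u : V -> R) :=
  [/\ weak_solution u, Nehari u & J u = ground_level].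

End Equation.

End Graph.

(* Main.v *)
Require Import Defs.
From mathcomp Require Import all_boot all_order all_algebra.
From mathcomp Require Import all_classical all_reals all_analysis.
From mathcomp Require Import finmap ring lra.
Set Implicit Arguments.
Unset Strict Implicit.
Unset Printing Implicit Defensive.
Import Order.TTheory GRing.Theory Num.Theory.
Import numFieldNormedType.Exports.
Local Open Scope classical_set_scope.
Local Open Scope ring_scope.

(** The ground state is found by solving a maximisation problem.  Put
    c = lambda a + 1 and let energy c u be the squared norm of u in E_lambda,
    and power u the integral of |u|^(p+1).  Among the u of E_lambda with
    energy c u <= 1, let S be the supremum of power u.  It is finite because
    a bound on the energy bounds u uniformly (the measure is uniformly
    positive) and bounds its L^2 norm.  If u attains S, then energy c u = 1,
    and the multiple v = t u with t^(p-1) S = 1 satisfies energy c v = power v.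
    Homogeneity gives power w <= S (energy c w)^((p+1)/2) for all w, so every
    point w of the Nehari manifold has energy c w >= t^2 = energy c v; since J
    is a positive multiple of the energy there, v minimises J.

    The supremum is attained (best_constant_attained) by compactness.  The
    maximisers up to epsilon take values in a fixed interval, so Tychonoff's
    theorem yields a filter of them that converges pointwise to some u.  By
    Fatou's lemma energy c u <= 1.  Since a tends to infinity and balls are
    finite, the sublevel sets of c are finite, and outside of {c < m} the
    integral of |w|^(p+1) is at most a constant over m (power_tail): no mass
    escapes, whence power u = S.  It remains to see that u belongs to the
    completion of the finitely supported functions, which a pointwise limit
    need not do.  Convexity of |.|^(p+1) shows that power stays close to S at
    the midpoint of two near-maximisers, so the energy of the midpoint is
    close to 1, and the parallelogram identity forces the two functions to be
    close in norm (close_maximizers).  Hence the convergence to u is strong.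

    The weak equation is the first order condition at s = 0 of the inequality
    power (u + s phi) <= S (energy c (u + s phi))^((p+1)/2), which is an
    equality there (euler_lagrange).  As phi has finite support and the graph
    is locally finite, both sides only change on a finite set of vertices. *)

(** * Integration over the vertices *)

Section Total.
Context {R : realType} {V : choiceType} (G : wgraph R V).
Implicit Types (f g : V -> R) (s : {fset V}).

(** The integral over the graph, for nonnegative f (integralV_ge0). *)
Definition vsum f : \bar R := (\esum_(x in setT) (meas G x * f x)%:E)%E.

Definition psum s f : R := \sum_(x <- s) meas G x * f x.

Lemma meas_mul_ge0 f x : 0 <= f x -> 0 <= meas G x * f x.
Proof. by move=> f0; rewrite mulr_ge0// ltW// meas_gt0. Qed.

Lemma vsum_ge0 f : (forall x, 0 <= f x) -> (0 <= vsum f)%E.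
Proof. by move=> f0; apply: esum_ge0 => x _; rewrite lee_fin meas_mul_ge0. Qed.

Lemma eq_vsum f g : f =1 g -> vsum f = vsum g.
Proof. by move=> /funext->. Qed.

Lemma le_vsum f g : (forall x, f x <= g x) -> (vsum f <= vsum g)%E.
Proof.
by move=> fg; apply: le_esum => x _; rewrite lee_fin ler_wpM2l// ltW// meas_gt0.
Qed.

Lemma vsumD f g : (forall x, 0 <= f x) -> (forall x, 0 <= g x) ->
  vsum (fun x => f x + g x) = (vsum f + vsum g)%E.
Proof.
move=> f0 g0; rewrite /vsum -esumD; last 2 first.
- by move=> x _; rewrite lee_fin meas_mul_ge0.
- by move=> x _; rewrite lee_fin meas_mul_ge0.
by apply: eq_esum => x _; rewrite mulrDr EFinD.
Qed.

Lemma psum_le_vsum s f : (forall x, 0 <= f x) ->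
  ((psum s f)%:E <= vsum f)%E.
Proof.
move=> f0; apply: esum_ge; exists [set` s]; first by split.
by rewrite fsbig_finite// set_fsetK /psum -sumEFin.
Qed.

Lemma vsum_le_psum f (M : \bar R) :
  (forall s, ((psum s f)%:E <= M)%E) -> (vsum f <= M)%E.
Proof.
move=> fM; apply: ge_ereal_sup => _ [X [finX _] <-].
by rewrite fsbig_finite// sumEFin; exact: fM.
Qed.

Lemma psumD s f g : psum s (fun x => f x + g x) = psum s f + psum s g.
Proof. by rewrite /psum -big_split; apply: eq_bigr => x _; rewrite mulrDr. Qed.

Lemma psumZ s (k : R) f : psum s (fun x => k * f x) = k * psum s f.
Proof.
by rewrite /psum mulr_sumr; apply: eq_bigr => x _; rewrite mulrCA.
Qed.

Lemma le_psum s f g : (forall x, x \in s -> f x <= g x) ->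
  psum s f <= psum s g.
Proof.
move=> fg; rewrite /psum big_seq [leRHS]big_seq; apply: ler_sum => x xs.
by rewrite ler_wpM2l ?fg// ltW// meas_gt0.
Qed.

Lemma eq_psum s f g : (forall x, x \in s -> f x = g x) ->
  psum s f = psum s g.
Proof. by move=> fg; apply: eq_big_seq => x /fg ->. Qed.

(** The constant may vanish while the integral is infinite, which is why the
    two inequalities are obtained separately, through finite sums. *)
Lemma vsumZ (k : R) f : 0 <= k -> (forall x, 0 <= f x) ->
  vsum (fun x => k * f x) = (k%:E * vsum f)%E.
Proof.
move=> k0 f0; apply/eqP; rewrite eq_le; apply/andP; split.
  apply: vsum_le_psum => s; rewrite psumZ EFinM.
  by apply: lee_pmul; rewrite ?lee_fin ?psum_le_vsum//;
    apply: sumr_ge0 => x _; exact: meas_mul_ge0.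
move: (k0); rewrite (le_eqVlt 0 k) => /predU1P[<-|{}k0].
  by rewrite mul0e; apply: vsum_ge0 => x; rewrite mul0r.
rewrite -lee_pdivlMl//; apply: vsum_le_psum => s.
rewrite lee_pdivlMl// -EFinM -psumZ psum_le_vsum// => x.
by rewrite mulr_ge0// ltW.
Qed.

Lemma vsum_finsupp s f : (forall x, 0 <= f x) ->
  (forall x, x \notin s -> f x = 0) -> vsum f = (psum s f)%:E.
Proof.
move=> f0 fs; rewrite /psum -sumEFin /vsum.
transitivity (\esum_(x in [set` s]) (meas G x * f x)%:E)%E.
  rewrite [RHS]esum_mkcond; apply: eq_esum => x _; case: ifPn => //.
  by rewrite mem_setE => /fs ->; rewrite mulr0.
rewrite esum_fset ?fsbig_finite ?set_fsetK// => x _.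
by rewrite lee_fin meas_mul_ge0.
Qed.

Definition off s f : V -> R := fun x => if x \in s then 0 else f x.

Lemma vsum_split s f : (forall x, 0 <= f x) ->
  vsum f = ((psum s f)%:E + vsum (off s f))%E.
Proof.
move=> f0; pose g x := if x \in s then f x else 0.
have g0 x : 0 <= g x by rewrite /g; case: ifP.
have h0 x : 0 <= off s f x by rewrite /off; case: ifP.
have <- : vsum g = (psum s f)%:E.
  rewrite (@vsum_finsupp s)//; last by move=> x /negbTE; rewrite /g => ->.
  by congr EFin; apply: eq_psum => x xs; rewrite /g xs.
rewrite -vsumD//; apply: eq_vsum => x; rewrite /g /off.
by case: ifP => _; rewrite ?addr0 ?add0r.
Qed.

Lemma integralV_ge0 f : (forall x, 0 <= f x) -> integralV G f = vsum f.
Proof.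
move=> f0; rewrite /integralV; set h := fun x => (meas G x * f x)%:E.
have h0 x : (0 <= h x)%E by rewrite lee_fin meas_mul_ge0.
rewrite (_ : h^\+ = h)%E; last by apply/funext => x; rewrite funeposE max_l.
rewrite (_ : h^\- = cst 0)%E; last first.
  by apply/funext => x; rewrite funenegE max_r// leeNl oppe0.
by rewrite (@esum1 _ _ setT (cst 0%E)) ?sube0.
Qed.

Lemma integralV_finsupp s f : (forall x, x \notin s -> f x = 0) ->
  integralV G f = (psum s f)%:E.
Proof.
move=> fs; rewrite /integralV.
set h := fun x => (meas G x * f x)%:E.
pose fp x := Num.max (f x) 0; pose fn x := Num.max (- f x) 0.
have -> : (\esum_(x in [set: V]) h^\+ x)%E = vsum fp.
  apply: eq_esum => x _.
  by rewrite funeposE /h /fp maxr_pMr ?(ltW (meas_gt0 _ _))// mulr0 EFin_max.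
have -> : (\esum_(x in [set: V]) h^\- x)%E = vsum fn.
  apply: eq_esum => x _.
  rewrite funenegE /h /fn maxr_pMr ?(ltW (meas_gt0 _ _))// mulr0 EFin_max.
  by rewrite mulrN EFinN.
rewrite !(@vsum_finsupp s) /fp /fn.
- rewrite -EFinB; congr EFin; rewrite /psum -sumrB; apply: eq_bigr => x _.
  rewrite -mulrBr; congr (_ * _).
  by case: (lerP 0 (f x)) => h0; [rewrite max_r ?oppr_le0// subr0|
    rewrite max_l ?oppr_ge0 ?(ltW h0)// opprK add0r].
- by move=> x; rewrite le_max lexx orbT.
- by move=> x /fs ->; rewrite oppr0 maxxx.
- by move=> x; rewrite le_max lexx orbT.
- by move=> x /fs ->; rewrite maxxx.
Qed.

(** A finite partial sum passes to the limit, and the integral is the supremum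
    of these sums; a filter serves as well as a sequence here, because only
    finitely many vertices are looked at simultaneously. *)
Lemma fatou_vsum (T : Type) (F : set_system T) {FF : ProperFilter F}
    (h : T -> V -> R) (h0 : V -> R) (M : R) :
  (forall x, h w x @[w --> F] --> h0 x) ->
  (forall w x, 0 <= h w x) ->
  (\forall w \near F, (vsum (h w) <= M%:E)%E) -> (vsum h0 <= M%:E)%E.
Proof.
move=> hh0 hge hM; apply: vsum_le_psum => s; rewrite lee_fin.
have cv : psum s (h w) @[w --> F] --> psum s h0.
  apply: cvg_big => [|x _]; first exact: add_continuous.
  by apply: cvgM; [exact: cvg_cst|exact: hh0].
apply: (cvgr_to_le cv).

by apply: filterS hM => w; rewrite -lee_fin; apply: le_trans; exact: psum_le_vsum.
Qed.

End Total.

(** * Dirichlet energies *)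

Section Energy.
Context {R : realType} {V : choiceType} (G : wgraph R V).
Hypothesis lfG : locally_finite G.
Implicit Types (c u v phi : V -> R) (x y : V) (s t : R).

(** Sums, differences, midpoints, multiples and perturbations are all written
    in this form, so that one expansion of the energy covers them. *)
Definition lin (s t : R) u v : V -> R := fun x => s * u x + t * v x.

Lemma scale_lin t u : (fun x => t * u x) = lin t 0 u u.
Proof. by apply/funext => x; rewrite /lin mul0r addr0. Qed.

Lemma GammaE u v x : Gamma G u v x = (2 * meas G x)^-1 *
  \sum_(y <- fset_set [set y | edge G x y])
     weight G x y * (u y - u x) * (v y - v x).
Proof. by rewrite /Gamma fsbig_finite//; exact: lfG. Qed.

Lemma grad2_lin s t u v x : grad2 G (lin s t u v) x =
  s ^+ 2 * grad2 G u x + 2 * s * t * Gamma G u v x + t ^+ 2 * grad2 G v x.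
Proof.
rewrite /grad2 !GammaE.
rewrite !(mulrCA _ (2 * meas G x)^-1) -!mulrDr; congr (_ * _).
rewrite !mulr_sumr -!big_split; apply: eq_bigr => y _ /=.
by rewrite /lin; ring.
Qed.

Lemma grad2_ge0 u x : 0 <= grad2 G u x.
Proof.
rewrite /grad2 GammaE mulr_ge0 ?invr_ge0 ?mulr_ge0 ?(ltW (meas_gt0 _ _))//.
rewrite big_seq sumr_ge0// => y; rewrite in_fset_set; last exact: lfG.
move=> /set_mem /= xy.
by rewrite -mulrA -expr2 mulr_ge0 ?sqr_ge0// ltW// weight_gt0.
Qed.

(** The energy density for the potential c: with c = lambda a + 1 it defines
    the norm of E_lambda, with c = 1 that of W^{1,2}. *)
Definition edens c u x := grad2 G u x + c x * u x ^+ 2.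

Definition bform c u v x := Gamma G u v x + c x * u x * v x.

Lemma edens_lin c s t u v x : edens c (lin s t u v) x =
  s ^+ 2 * edens c u x + 2 * s * t * bform c u v x + t ^+ 2 * edens c v x.
Proof. by rewrite /edens /bform grad2_lin /lin; ring. Qed.

Lemma edens_scale c t u x : edens c (fun z => t * u z) x = t ^+ 2 * edens c u x.
Proof. by rewrite scale_lin edens_lin; ring. Qed.

Lemma edens_parallelogram c s t u v x :
  edens c (lin s t u v) x + edens c (lin s (- t) u v) x =
  2 * s ^+ 2 * edens c u x + 2 * t ^+ 2 * edens c v x.
Proof. by rewrite !edens_lin; ring. Qed.

Definition energy c u : \bar R := vsum G (edens c u).

Section nonneg.
Variable c : V -> R.
Hypothesis c0 : forall x, 0 <= c x.

Lemma edens_ge0 u x : 0 <= edens c u x.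
Proof. by rewrite addr_ge0 ?grad2_ge0// mulr_ge0 ?sqr_ge0. Qed.

Lemma energy_ge0 u : (0 <= energy c u)%E.
Proof. by apply: vsum_ge0 => x; exact: edens_ge0. Qed.

Lemma energy_parallelogram s t u v :
  (energy c (lin s t u v) + energy c (lin s (- t) u v) =
  (2 * s ^+ 2)%:E * energy c u + (2 * t ^+ 2)%:E * energy c v)%E.
Proof.
have E0 := edens_ge0; have S0 (k : R) : 0 <= 2 * k ^+ 2.
  by rewrite mulr_ge0// sqr_ge0.
rewrite /energy -!vsumZ// -!vsumD//; try by move=> x; rewrite mulr_ge0.
by apply: eq_vsum => x; rewrite edens_parallelogram.
Qed.

Lemma energy_scale t u :
  energy c (fun x => t * u x) = ((t ^+ 2)%:E * energy c u)%E.
Proof.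
rewrite /energy -vsumZ ?sqr_ge0//; last exact: edens_ge0.
by apply: eq_vsum => x; rewrite edens_scale.
Qed.

(** A substitute for the triangle inequality that stays with squared norms:
    the second term of the parallelogram identity is dropped. *)
Lemma energy_lin_le s t u v (A B : R) :
  (energy c u <= A%:E)%E -> (energy c v <= B%:E)%E ->
  (energy c (lin s t u v) <= (2 * s ^+ 2 * A + 2 * t ^+ 2 * B)%:E)%E.
Proof.
move=> uA vB; apply: (@le_trans _ _ (energy c (lin s t u v) +
  energy c (lin s (- t) u v))%E); first by rewrite leeDl// energy_ge0.
rewrite energy_parallelogram EFinD; apply: leeD.
  by rewrite (EFinM _ A) lee_wpmul2l// lee_fin mulr_ge0// sqr_ge0.
by rewrite (EFinM _ B) lee_wpmul2l// lee_fin mulr_ge0// sqr_ge0.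
Qed.

Lemma energy_fin u : (energy c u < +oo)%E -> exists2 A, 0 <= A & energy c u = A%:E.
Proof.
move=> uoo; exists (fine (energy c u)); first by rewrite fine_ge0// energy_ge0.
by rewrite fineK// ge0_fin_numE ?energy_ge0.
Qed.

Lemma energy_lin_fin s t u v : (energy c u < +oo)%E -> (energy c v < +oo)%E ->
  (energy c (lin s t u v) < +oo)%E.
Proof.
move=> /energy_fin[A _ uA] /energy_fin[B _ vB].
apply: (@le_lt_trans _ _ (2 * s ^+ 2 * A + 2 * t ^+ 2 * B)%:E); last exact: ltry.
by apply: energy_lin_le; rewrite ?uA ?vB.
Qed.

Lemma meas_sqr_le_energy u x : 
  ((meas G x * (c x * u x ^+ 2))%:E <= energy c u)%E.
Proof.
apply: le_trans (psum_le_vsum G [fset x]%fset _); last exact: edens_ge0.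
rewrite lee_fin /psum big_seq_fset1 ler_wpM2l ?(ltW (meas_gt0 _ _))//.
by rewrite /edens lerDr grad2_ge0.
Qed.

End nonneg.

Lemma le_energy c c' u : (forall x, c x <= c' x) ->
  (energy c u <= energy c' u)%E.
Proof.
move=> cc'; apply: le_vsum => x; rewrite /edens lerD2l.
by rewrite ler_wpM2r ?sqr_ge0.
Qed.

Lemma Gamma_far u phi x : phi x = 0 -> (forall y, edge G x y -> phi y = 0) ->
  Gamma G u phi x = 0.
Proof.
move=> px py; rewrite GammaE big_seq big1 ?mulr0// => y.
rewrite in_fset_set; last exact: lfG.
by move=> /set_mem /py ->; rewrite px subrr mulr0.
Qed.

(** By local finiteness the support of phi together with its neighbours is
    finite; all integrands that are tested against phi vanish outside. *)
Lemma Cc_nbhd phi : Cc phi -> exists s : {fset V},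
  (forall x, x \notin s -> phi x = 0) /\
  (forall u x, x \notin s -> Gamma G u phi x = 0).
Proof.
rewrite /Cc /= => fphi; set A := [set x | phi x != 0] in fphi.
pose B := A `|` \bigcup_(x in A) [set y | edge G x y].
have fB : finite_set B.
  rewrite finite_setU; split => //; apply: bigcup_finite => // x _; exact: lfG.
exists (fset_set B).
have phi0 x : x \notin fset_set B -> phi x = 0.
  rewrite in_fset_set// notin_setE => xB; apply/eqP/negPn/negP => px.
  by apply: xB; left.
split=> // u x xB; apply: Gamma_far; first exact: phi0.
move=> y xy; apply/eqP/negPn/negP => py; move: xB.
rewrite in_fset_set// notin_setE; apply; right; exists y => //=.
by rewrite edge_sym.
Qed.

Lemma Cc_energy_fin c phi : (forall x, 0 <= c x) -> Cc phi ->
  (energy c phi < +oo)%E.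
Proof.
move=> c0 /Cc_nbhd[s [p0 g0]].
rewrite /energy (@vsum_finsupp _ _ _ s) ?ltry//; first by move=> x; exact: edens_ge0.
by move=> x xs; rewrite /edens /grad2 g0// p0// expr0n mulr0 addr0.
Qed.

Lemma Cc_lin s t u v : Cc u -> Cc v -> Cc (lin s t u v).
Proof.
rewrite /Cc /= => fu fv.
have : finite_set ([set x | u x != 0] `|` [set x | v x != 0]).
  by rewrite finite_setU.
apply: sub_finite_set => x /=.
case: (eqVneq (u x) 0) => [ux|]; last by left.
case: (eqVneq (v x) 0) => [vx|]; last by right.
by rewrite /lin ux vx !mulr0 addr0 eqxx.
Qed.

Lemma edens1 u : edens (cst 1%R) u = (fun x => grad2 G u x + u x ^+ 2).
Proof. by apply/funext => x; rewrite /edens mul1r. Qed.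

Lemma E1_ge0 (x : V) : (0 : R) <= cst 1 x. Proof. exact: ler01. Qed.

Lemma W12_normE u : W12_norm G u = (energy (cst 1%R) u `^ 2^-1)%E.
Proof.
rewrite /W12_norm -edens1 integralV_ge0// => x.
by apply: edens_ge0 => {}x; exact: E1_ge0.
Qed.


Lemma poweR_half_le (x : \bar R) (e : R) : (0 <= x)%E -> 0 <= e ->
  (x `^ 2^-1 <= e%:E)%E = (x <= (e ^+ 2)%:E)%E.
Proof.
move=> x0 e0; rewrite poweR12_sqrt//.
have -> : e%:E = sqrte (e ^+ 2)%:E by rewrite /= sqrtr_sqr ger0_norm.
by rewrite lee_sqrt// lee_fin sqr_ge0.
Qed.

(** Membership in the completion, without square roots or sequences. *)
Lemma W12P u : W12 G u <-> forall e : R, 0 < e ->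
  exists2 phi, Cc phi & (energy (cst 1%R) (phi \- u)%R <= e%:E)%E.
Proof.
split=> [[phi phiC cv] e e0|H].
  have e20 : 0 < Num.sqrt e by rewrite sqrtr_gt0.
  have : \forall n \near \oo, (W12_norm G (phi n \- u)%R < (Num.sqrt e)%:E)%E.
    move/fine_cvgP : cv => [fin /cvgrPdist_lt /(_ _ e20)].
    apply: filterS2 fin => n fn; rewrite sub0r normrN ger0_norm /=.
      by rewrite -lte_fin fineK.
    by rewrite fine_ge0// poweR_ge0.
  move=> [N _ /(_ N (leqnn _)) /= nN]; exists (phi N); first exact: phiC.
  move: nN; rewrite W12_normE => /ltW; rewrite poweR_half_le ?sqrtr_ge0//.
    by rewrite sqr_sqrtr// ltW.
  by apply: energy_ge0 => x; exact: E1_ge0.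
have h0 n : (0 : R) < (harmonic n) ^+ 2 by rewrite exprn_gt0//= invr_gt0.
pose phi n := projT1 (cid2 (H _ (h0 n))).
exists phi => [n|]; first by rewrite /phi; case: cid2.
apply: (@squeeze_cvge _ _ _ _ (cst 0%E) _ (fun n => (harmonic n)%:E)).
- apply: nearW => n; rewrite poweR_ge0 W12_normE poweR_half_le//=.
  + by rewrite /phi; case: cid2.
  + by apply: energy_ge0 => x; exact: E1_ge0.
- exact: cvg_cst.
- by apply: cvg_EFin; [exact: nearW|exact: cvg_harmonic].
Qed.

End Energy.

Lemma bform_scale (R : realType) (V : choiceType) (G : wgraph R V)
    (lfG : locally_finite G) (c u phi : V -> R) (t : R) x :
  bform G c (fun z => t * u z) phi x = t * bform G c u phi x.
Proof.
rewrite /bform !GammaE// [RHS]mulrDr; congr (_ + _); last by ring.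
rewrite [RHS]mulrCA; congr (_ * _); rewrite mulr_sumr.
by apply: eq_bigr => y _; ring.
Qed.

(** * Convexity of the power function *)

Section RealPower.
Context {R : realType} (p : R).
Hypothesis p_gt1 : 1 < p.
Implicit Types a b : R.

Let p_gt0 : 0 < p. Proof. exact: lt_trans p_gt1. Qed.

Lemma powR_sqr a : `|a| `^ (p - 1) * a * a = `|a| `^ (p + 1).
Proof.
rewrite -mulrA -expr2 -[a ^+ 2]real_normK ?num_real// -powR_mulrn// -powRD.
  by congr (_ `^ _); ring.
by apply/implyP => /eqP h; exfalso; move: h p_gt0; lra.
Qed.

(** The convexity of |.|^(p+1): its graph lies above the tangent at a.  This
    is Young's inequality for |a|^p and |b|.  At a = 0 the slope is 0. *)
Lemma powR_tangent a b :
  (p + 1) * (`|a| `^ (p - 1) * a * b) <= p * `|a| `^ (p + 1) + `|b| `^ (p + 1).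
Proof.
have p1 : 0 < p + 1 by rewrite addr_gt0.
have h : `|a| `^ (p - 1) * a * b <= `|a| `^ p * `|b|.
  rewrite -(mulr_powRB1 (normr_ge0 a) p_gt0) (le_trans (ler_norm _))//.
  by rewrite !normrM (ger0_norm (powR_ge0 _ _)) (mulrC `|a|).
rewrite (le_trans (ler_wpM2l (ltW p1) h))//.
have q0 : 0 < (p + 1) / p by rewrite divr_gt0.
have pq : ((p + 1) / p)^-1 + (p + 1)^-1 = 1.
  by field; rewrite !gt_eqF.
have := conjugate_powR (powR_ge0 `|a| p) (normr_ge0 b) q0 p1 pq.
rewrite -powRrM (_ : p * ((p + 1) / p) = p + 1); last by field; rewrite gt_eqF.
move=> /(ler_wpM2l (ltW p1)) /le_trans; apply.
rewrite le_eqVlt; apply/orP; left; apply/eqP; field.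
by rewrite !gt_eqF.
Qed.

(** The tangent inequality at a, with the slope bounded by means of K. *)
Lemma powR_lip a b (K : R) : `|a| <= K ->
  `|a| `^ (p + 1) <= `|b| `^ (p + 1) + (p + 1) * K `^ p * `|a - b|.
Proof.
move=> aK; have := powR_tangent a b.
have p1 : 0 < p + 1 by rewrite addr_gt0.
have h : `|a| `^ (p - 1) * a * (a - b) <= K `^ p * `|a - b|.
  rewrite (le_trans (ler_norm _))// !normrM (ger0_norm (powR_ge0 _ _)).
  rewrite ler_wpM2r// (mulrC _ `|a|) mulr_powRB1//.
  rewrite ge0_ler_powR ?nnegrE ?(ltW p_gt0)//.
  exact: le_trans aK.
have := ler_wpM2l (ltW p1) h; rewrite mulrBr powR_sqr.
lra.
Qed.

End RealPower.

(** * The energy space and its embedding *)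

Section Space.
Context {R : realType} {V : choiceType} (G : wgraph R V).
Hypothesis lfG : locally_finite G.
Implicit Types (u v w phi : V -> R) (x : V) (s t e : R).

Let E1 := @E1_ge0 R V.

Lemma W12_lin s t u v : W12 G u -> W12 G v -> W12 G (lin s t u v).
Proof.
move=> /(W12P lfG) Wu /(W12P lfG) Wv; apply/(W12P lfG) => e e0.
pose K := 2 * s ^+ 2 + 2 * t ^+ 2 + 1.
have K0 : 0 < K by rewrite ltr_pwDr// addr_ge0// mulr_ge0// sqr_ge0.
have d0 : 0 < e / K by rewrite divr_gt0.
have [phi phiC phiu] := Wu _ d0; have [psi psiC psiv] := Wv _ d0.
exists (lin s t phi psi); first exact: Cc_lin.
have -> : lin s t phi psi \- lin s t u v = lin s t (phi \- u) (psi \- v).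
  by apply/funext => x; rewrite /lin /=; ring.
apply: le_trans (energy_lin_le lfG E1 s t phiu psiv) _.
rewrite lee_fin -mulrDl mulrA ler_pdivrMr// mulrC ler_pM2l//.
by rewrite /K lerDl.
Qed.

Lemma Cc_W12 phi : Cc phi -> W12 G phi.
Proof.
move=> phiC; apply/(W12P lfG) => e e0; exists phi => //.
have -> : phi \- phi = (fun x => 0 * phi x).
  by apply/funext => x /=; rewrite subrr mul0r.
by rewrite energy_scale// expr0n mul0e lee_fin ltW.
Qed.

(** A diagonal argument: the completion is complete. *)
Lemma W12_closed u : (forall e, 0 < e -> exists2 w, W12 G w &
  (energy G (cst 1%R) (w \- u)%R <= e%:E)%E) -> W12 G u.
Proof.
move=> H; apply/(W12P lfG) => e e0.
have d0 : 0 < e / 4 by rewrite divr_gt0.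
have [w /(W12P lfG)/(_ _ d0)[phi phiC phiw] wu] := H _ d0.
exists phi => //.
have -> : phi \- u = lin 1 1 (phi \- w) (w \- u).
  by apply/funext => x; rewrite /lin /=; ring.
apply: le_trans (energy_lin_le lfG E1 1 1 phiw wu) _.
by rewrite lee_fin; lra.
Qed.

Variable c : V -> R.
Hypothesis c_ge1 : forall x, 1 <= c x.

Let c0 x : 0 <= c x. Proof. exact: le_trans ler01 (c_ge1 x). Qed.

(** The energy space E_lambda for c = lambda a + 1; the finiteness of the
    whole energy replaces that of the integral of lambda a u^2. *)
Definition Espace u := W12 G u /\ (energy G c u < +oo)%E.

Lemma Espace_lin s t u v : Espace u -> Espace v -> Espace (lin s t u v).
Proof.
by move=> [Wu fu] [Wv fv]; split; [exact: W12_lin|exact: energy_lin_fin].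
Qed.

Lemma Cc_Espace phi : Cc phi -> Espace phi.
Proof. by move=> phiC; split; [exact: Cc_W12|exact: Cc_energy_fin]. Qed.

Lemma Espace_scale t u : Espace u -> Espace (fun x => t * u x).
Proof. by move=> Eu; rewrite scale_lin; exact: Espace_lin. Qed.

Lemma Espace_closed u : (energy G c u < +oo)%E ->
  (forall e, 0 < e -> exists2 w, Espace w &
    (energy G c (w \- u)%R <= e%:E)%E) -> Espace u.
Proof.
move=> fu H; split=> //; apply: W12_closed => e /H[w [Ww _] wu].
by exists w => //; apply: le_trans wu; exact: le_energy.
Qed.

Variable p : R.
Hypothesis p_gt1 : 1 < p.

Let p1_gt0 : 0 < p + 1. Proof. by rewrite addr_gt0// (lt_trans ltr01). Qed.
Let p1_ne0 : p + 1 != 0. Proof. exact: lt0r_neq0. Qed.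

Definition power u : \bar R := vsum G (fun x => `|u x| `^ (p + 1)).

Lemma power_ge0 u : (0 <= power u)%E.
Proof. by apply: vsum_ge0 => x; exact: powR_ge0. Qed.

Lemma power_scale t u : 0 <= t ->
  power (fun x => t * u x) = ((t `^ (p + 1))%:E * power u)%E.
Proof.
move=> t0; rewrite /power -vsumZ ?powR_ge0//.
by apply: eq_vsum => x; rewrite normrM powRM// (ger0_norm t0).
Qed.

Variable mu : R.
Hypothesis mu_gt0 : 0 < mu.
Hypothesis mu_le : forall x, mu <= meas G x.

Lemma energy_bound u x : (energy G c u <= 1)%E -> `|u x| <= Num.sqrt mu^-1.
Proof.
move=> u1; have := le_trans (meas_sqr_le_energy lfG c0 u x) u1.
rewrite lee_fin => h; rewrite -sqrtr_sqr ler_sqrt ?invr_ge0 ?(ltW mu_gt0)//.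
rewrite -[X in _ <= X]mulr1 ler_pdivlMl//; apply: le_trans h.
apply: ler_pM; rewrite ?sqr_ge0 ?(ltW mu_gt0)//.
by rewrite ler_peMl// sqr_ge0.
Qed.

(** The bound of |u|^(p-1) on the unit ball of the energy space. *)
Definition kappa := Num.sqrt mu^-1 `^ (p - 1).

Lemma kappa_ge0 : 0 <= kappa. Proof. exact: powR_ge0. Qed.

(** Two of the p + 1 factors |u| are absorbed by the energy density, where
    the potential is at least m; the others are bounded uniformly. *)
Lemma power_le_edens u x (m : R) : (energy G c u <= 1)%E -> 0 < m -> m <= c x ->
  `|u x| `^ (p + 1) <= kappa / m * edens G c u x.
Proof.
move=> u1 m0 mc.
rewrite -(powR_sqr p_gt1) -mulrA -expr2 -[leRHS]mulrA.
apply: ler_pM; rewrite ?powR_ge0 ?sqr_ge0//.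
  apply: ge0_ler_powR; rewrite ?nnegrE ?sqrtr_ge0// ?subr_ge0 ?(ltW p_gt1)//.
  exact: energy_bound.
rewrite ler_pdivlMl// /edens (le_trans (ler_wpM2r (sqr_ge0 _) mc))//.
by rewrite lerDr grad2_ge0.
Qed.

Lemma power_le u : (energy G c u <= 1)%E -> (power u <= kappa%:E)%E.
Proof.
move=> u1; apply: (@le_trans _ _ (kappa%:E * energy G c u)%E).
  rewrite /energy -vsumZ ?kappa_ge0//; last by move=> x; exact: edens_ge0.
  apply: le_vsum => x; rewrite -[X in X * _]divr1; exact: power_le_edens.
by rewrite -[leRHS]mule1 lee_wpmul2l// lee_fin kappa_ge0.
Qed.

(** Mass cannot escape to infinity: what lies outside of the finite set
    {c < m} is small, uniformly on the unit ball. *)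
Lemma power_tail u (m : R) : finite_set [set x | c x < m] -> 0 < m ->
  (energy G c u <= 1)%E ->
  (power u <= (psum G (fset_set [set x | c x < m])
                 (fun x => `|u x| `^ (p + 1)) + kappa / m)%:E)%E.
Proof.
move=> fm m0 u1; set s := fset_set _; rewrite /power (@vsum_split _ _ _ s).
  rewrite EFinD leeD2l//.
  apply: (@le_trans _ _ ((kappa / m)%:E * energy G c u)%E).
    rewrite /energy -vsumZ ?divr_ge0 ?kappa_ge0 ?(ltW m0)//;
      last by move=> x; exact: edens_ge0.
    apply: le_vsum => x; rewrite /off; case: ifPn => [_|].
      by rewrite mulr_ge0 ?edens_ge0// divr_ge0 ?kappa_ge0// ltW.
    rewrite in_fset_set// notin_setE => /negP; rewrite -leNgt => mc.
    exact: power_le_edens.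
  by rewrite -[leRHS]mule1 lee_wpmul2l// lee_fin divr_ge0 ?kappa_ge0// ltW.
by move=> x; exact: powR_ge0.
Qed.

Lemma energy_eq0 u x : energy G c u = 0%E -> u x = 0.
Proof.
move=> h; have := meas_sqr_le_energy lfG c0 u x; rewrite h lee_fin => h2.
apply/eqP; rewrite -sqrf_eq0 eq_le sqr_ge0 andbT.
have cm : 0 < meas G x * c x.
  by rewrite mulr_gt0 ?meas_gt0// (lt_le_trans ltr01).
by rewrite -(pmulr_rle0 _ cm) -mulrA.
Qed.

(** S is the supremum of power on the unit ball of the energy space.  It is
    positive because the ball contains a multiple of the indicator function
    of x0. *)
Lemma best_constant (x0 : V) : exists2 S : R, 0 < S &
  (forall w, Espace w -> (energy G c w <= 1)%E -> (power w <= S%:E)%E) /\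
  (forall e, 0 < e -> exists w, [/\ Espace w, (energy G c w <= 1)%E &
     ((S - e)%:E <= power w)%E]).
Proof.
pose A := [set fine (power w) | w in [set w | Espace w /\ (energy G c w <= 1)%E]].
have pfin w : (energy G c w <= 1)%E -> power w = (fine (power w))%:E.
  move=> /power_le w1; rewrite fineK// ge0_fin_numE ?power_ge0//.
  by apply: le_lt_trans w1 _; exact: ltry.
have Aub : has_ubound A.
  exists kappa => _ [w [_ w1] <-]; rewrite -lee_fin -pfin//; exact: power_le.
pose d x : R := (x == x0)%:R.
have dC : Cc d.
  rewrite /Cc /=; apply: (@sub_finite_set _ _ [set x0]) => // x /=.
  by rewrite /d; have [//|_] := eqVneq x x0; rewrite mulr0n eqxx.
have [D D0 dD] := energy_fin lfG c0 (Cc_energy_fin lfG c0 dC).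
have Dgt0 : 0 < D.
  rewrite lt0r D0 andbT; apply/eqP => D00.
  have := @energy_eq0 d x0; rewrite dD D00 => /(_ erefl) /eqP.
  by rewrite /d eqxx oner_eq0.
pose w0 x := (Num.sqrt D)^-1 * d x.
have w0E : Espace w0 by exact/Espace_scale/Cc_Espace.
have w01 : (energy G c w0 <= 1)%E.
  by rewrite /w0 energy_scale// dD -EFinM exprVn sqr_sqrtr// mulVf ?gt_eqF.
have Aw0 : A (fine (power w0)) by exists w0.
have w0gt0 : 0 < fine (power w0).
  rewrite -lte_fin -pfin//.
  apply: lt_le_trans (psum_le_vsum G [fset x0]%fset _); last first.
    by move=> x; exact: powR_ge0.
  rewrite lte_fin /psum big_seq_fset1 mulr_gt0 ?meas_gt0// powR_gt0//.
  by rewrite /w0 /d eqxx mulr1 normr_gt0 invr_eq0 sqrtr_eq0 -ltNge.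
have Asup : has_sup A by split; first by exists (fine (power w0)).
exists (sup A); first by apply: lt_le_trans w0gt0 _; exact: ub_le_sup.
split=> [w Ew w1|e e0].
  by rewrite pfin// lee_fin; apply: ub_le_sup => //; exists w.
have [_ [w [Ew w1] <-] ew] := sup_adherent e0 Asup.
by exists w; split=> //; rewrite pfin// lee_fin ltW.
Qed.

(** power is homogeneous of degree p + 1 and the energy of degree 2, so the
    bound on the unit ball extends to the whole space. *)
Lemma power_homogeneous (S A : R) w : 0 <= A ->
  (forall w, Espace w -> (energy G c w <= 1)%E -> (power w <= S%:E)%E) ->
  Espace w -> energy G c w = A%:E ->
  (power w <= (S * A `^ ((p + 1) / 2))%:E)%E.
Proof.
rewrite le_eqVlt => /predU1P[<- _ _ w0|A0 HS Ew wA].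
  rewrite /power (@eq_vsum _ _ _ _ (fun x => 0 * 0)).
    by rewrite vsumZ// mul0e powR0 ?mulr0// gt_eqF// divr_gt0.
  by move=> x; rewrite (energy_eq0 x w0) normr0 powR0// mul0r.
(* t is the inverse of the norm of w *)
pose t := A `^ (- 2^-1).
have t0 : 0 <= t by exact: powR_ge0.
have tA : t ^+ 2 * A = 1.
  rewrite /t -powR_mulrn ?powR_ge0// -powRrM mulNr mulVf// powR_inv1 ?ltW//.
  by rewrite mulVf// gt_eqF.
have := HS _ (Espace_scale t Ew).
rewrite energy_scale// wA -EFinM tA lexx => /(_ isT).
rewrite power_scale// /t -powRrM mulNr powRN muleC lee_pdivrMr ?powR_gt0//.
by rewrite EFinM [2^-1 * _]mulrC.
Qed.

End Space.

(** * The best constant is attained *)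

(** Tychonoff's theorem, in the product of the intervals [-K, K] over the
    vertices.  A filter finer than F replaces an extracted subsequence. *)
Lemma pointwise_cluster (R : realType) (V : choiceType)
    (F : set_system (V -> R)) (FF : ProperFilter F) (K : R) :
  (\forall w \near F, forall x, `|w x| <= K) ->
  exists (u : V -> R) (H : set_system (V -> R)), [/\ ProperFilter H, F `<=` H &
    forall x, w x @[w --> H] --> u x].
Proof.
move=> FK.
have cK := @tychonoff V (fun=> R) (fun=> `[- K, K]%classic)
  (fun=> @segment_compact R (- K) K).
have FK' : F [set f : V -> R | forall x, `[- K, K]%classic (f x)].
  by apply: filterS FK => w wK x; rewrite /= in_itv /= -ler_norml.
have [u [_ +]] := cK F FF FK'.
rewrite cluster_cvgE => -[H HF [Hu FH]]; exists u, H; split=> // x.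
apply: (@cvg_comp _ _ _ id (fun w : V -> R => w x) H _ _ Hu).
exact: (@proj_continuous V (fun=> R) x u).
Qed.

Section Attained.
Context {R : realType} {V : choiceType} (G : wgraph R V).
Hypothesis lfG : locally_finite G.
Implicit Types (u v w phi : V -> R) (x : V) (s t e : R).
Variable c : V -> R.
Hypothesis c_ge1 : forall x, 1 <= c x.
Hypothesis c_coercive : forall m : R, finite_set [set x | c x < m].
Variable p : R.
Hypothesis p_gt1 : 1 < p.
Variable mu : R.
Hypothesis mu_gt0 : 0 < mu.
Hypothesis mu_le : forall x, mu <= meas G x.

Let c0 x : 0 <= c x. Proof. exact: le_trans ler01 (c_ge1 x). Qed.
Let p_gt0 : 0 < p. Proof. exact: lt_trans p_gt1. Qed.
Let p1_gt0 : 0 < p + 1. Proof. by rewrite addr_gt0. Qed.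

Lemma edens_cvg (T : Type) (F : set_system T) {FF : Filter F}
    (h : T -> V -> R) u x :
  (forall z, h w z @[w --> F] --> u z) ->
  edens G c (h w) x @[w --> F] --> edens G c u x.
Proof.
move=> hu; rewrite /edens /grad2.
under eq_cvg do rewrite GammaE//.
rewrite GammaE//; apply: cvgD; last first.
  by apply: cvgM; [exact: cvg_cst|rewrite expr2; apply: cvgM; exact: hu].
apply: cvgM; first exact: cvg_cst.
apply: cvg_big => [|y _]; first exact: add_continuous.
apply: cvgM; last by apply: cvgB; exact: hu.
by apply: cvgM; [exact: cvg_cst|apply: cvgB; exact: hu].
Qed.

Lemma psum_cvg (T : Type) (F : set_system T) {FF : Filter F}
    (h : T -> V -> R) (h0 : V -> R) (D : {fset V}) :
  (forall x, h w x @[w --> F] --> h0 x) ->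
  psum G D (h w) @[w --> F] --> psum G D h0.
Proof.
move=> hh0; apply: cvg_big => [|x _]; first exact: add_continuous.
by apply: cvgM; [exact: cvg_cst|exact: hh0].
Qed.

Let pw u x := `|u x| `^ (p + 1).
Let dpw u w x := `|u x| `^ (p - 1) * u x * w x.

Variable S : R.
Hypothesis S_gt0 : 0 < S.
Hypothesis S_ub : forall w, Espace G c w -> (energy G c w <= 1)%E ->
  (power G p w <= S%:E)%E.

(** On the unit ball the exponent (p+1)/2 >= 1 may be lowered to 1. *)
Lemma power_le_energy w (A : R) : Espace G c w -> energy G c w = A%:E ->
  A <= 1 -> (power G p w <= (S * A)%:E)%E.
Proof.
move=> Ew wA A1.
have A0 : 0 <= A by rewrite -lee_fin -wA energy_ge0.
apply: le_trans (power_homogeneous lfG c_ge1 p_gt1 A0 S_ub Ew wA) _.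
rewrite lee_fin ler_pM2l//.
move: A0; rewrite le_eqVlt => /predU1P[<-|A0].
  by rewrite powR0// gt_eqF// divr_gt0.
apply: ge1r_powR; first by rewrite A0.
by move: p_gt1 => h; lra.
Qed.

(** Uniform convexity at work.  The tangent inequality at u, summed over D,
    bounds power from below at the midpoint of w1 and w2 by a linear quantity,
    hence by its values at w1 and w2.  So the energy A of the midpoint is
    nearly 1, and by the parallelogram identity the energy B of half the
    difference is at most 1 - A.  This is applied to a pointwise limit u
    before u is known to belong to the energy space. *)
Lemma close_maximizers (D : {fset V}) u w1 w2 (eta e : R) :
  Espace G c w1 -> Espace G c w2 ->
  (energy G c w1 <= 1)%E -> (energy G c w2 <= 1)%E ->
  S - eta <= psum G D (pw u) ->
  psum G D (pw u) - e <= psum G D (dpw u w1) ->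
  psum G D (pw u) - e <= psum G D (dpw u w2) ->
  (energy G c (w1 \- w2)%R <= (4 * (eta + (p + 1) * e) / S)%:E)%E.
Proof.
move=> E1 E2 w1le w2le Su uw1 uw2.
pose v := lin 2^-1 2^-1 w1 w2.
have Ev : Espace G c v by exact: Espace_lin.
have [A A0 vA] := energy_fin lfG c0 Ev.2.
pose d := lin 2^-1 (- 2^-1) w1 w2.
have [B B0 dB] := energy_fin lfG c0 (Espace_lin lfG c_ge1 2^-1 (- 2^-1) E1 E2).2.
have [A1 A10 wA1] := energy_fin lfG c0 E1.2.
have [A2 A20 wA2] := energy_fin lfG c0 E2.2.
have AB : A + B = 2^-1 * A1 + 2^-1 * A2.
  apply/EFin_inj; rewrite !EFinD -vA -dB energy_parallelogram// wA1 wA2.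
  by rewrite -!EFinM; congr (_%:E + _%:E)%E; field.
move: w1le w2le; rewrite wA1 wA2 !lee_fin => A1le A2le.
have A1' : A <= 1 by lra.
have SA : psum G D (pw v) <= S * A.
  rewrite -lee_fin; apply: le_trans (power_le_energy Ev vA A1').
  by apply: psum_le_vsum => x; exact: powR_ge0.
have tang : (p + 1) * psum G D (dpw u v) <= p * psum G D (pw u) + psum G D (pw v).
  rewrite -!psumZ -psumD; apply: le_psum => x _; exact: powR_tangent.
have lind : psum G D (dpw u v) =
    2^-1 * psum G D (dpw u w1) + 2^-1 * psum G D (dpw u w2).
  rewrite -!psumZ -psumD; apply: eq_psum => x _; rewrite /dpw /v /lin; ring.
have uv : psum G D (pw u) - e <= psum G D (dpw u v) by lra.
have := ler_wpM2l (ltW p1_gt0) uv => uv'.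
have Sd : S - (eta + (p + 1) * e) <= S * A by lra.
have -> : (w1 \- w2) = (fun x => 2 * d x).
  by apply/funext => x; rewrite /d /lin /=; field.
rewrite energy_scale// dB -EFinM lee_fin ler_pdivlMr//.
have : S * B <= S * (1 - A) by rewrite ler_pM2l//; lra.
by lra.
Qed.

Hypothesis S_approx : forall e, 0 < e -> exists w, [/\ Espace G c w,
  (energy G c w <= 1)%E & ((S - e)%:E <= power G p w)%E].

(** The limit u of near-maximisers is first compared with S on the finite sets
    {c < m}, then shown to be a strong limit, hence an element of the energy
    space, and only then is the bound S available for u itself. *)
Theorem best_constant_attained : exists u, [/\ Espace G c u,
  (energy G c u <= 1)%E & power G p u = S%:E].
Proof.
have /choice[w_ w_P] : forall n : nat, exists w, [/\ Espace G c w,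
    (energy G c w <= 1)%E & ((S - harmonic n)%:E <= power G p w)%E].
  by move=> n; apply: S_approx; rewrite /harmonic invr_gt0.
pose K := Num.sqrt mu^-1.
have FK : \forall w \near (w_ n @[n --> \oo]), forall x, `|w x| <= K.
  exists 0%N => // n _ x; have [_ w1 _] := w_P n.
  exact: (energy_bound lfG c_ge1 mu_gt0 mu_le).
have [u [H [HF FH Hu]]] := pointwise_cluster _ FK.
have H1 : \forall w \near H, Espace G c w /\ (energy G c w <= 1)%E.
  by apply: FH; exists 0%N => // n _ /=; have [] := w_P n.
have HS e : 0 < e -> \forall w \near H, ((S - e)%:E <= power G p w)%E.
  move=> e0; apply: FH.
  have : \forall n \near \oo, harmonic n < e.
    have /cvgrPdist_lt /(_ _ e0) := @cvg_harmonic R.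
    by apply: filterS => n; rewrite sub0r normrN ger0_norm// /harmonic invr_ge0.
  apply: filterS => n ne /=; have [_ _] := w_P n; apply: le_trans.
  by rewrite lee_fin lerD2l lerN2 ltW.
have u1 : (energy G c u <= 1)%E.
  apply: (@fatou_vsum _ _ G _ H _ (edens G c)).
  - by move=> x; exact: edens_cvg.
  - by move=> w x; exact: edens_ge0.
  - by apply: filterS H1 => w [].
pose D m := fset_set [set x | c x < m].
have Spsum m : 0 < m -> S - kappa p mu / m <= psum G (D m) (pw u).
  move=> m0; apply/ler_addgt0Pr => e e0; rewrite -lerBlDr.
  have cv : psum G (D m) (fun x => pw u x + (p + 1) * K `^ p * `|w x - u x|)
      @[w --> H] --> psum G (D m) (pw u).
    apply: psum_cvg => x; rewrite -[X in _ --> X]addr0.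
    apply: cvgD; first exact: cvg_cst.
    rewrite -[X in _ --> X](mulr0 ((p + 1) * K `^ p)).
    apply: cvgM; first exact: cvg_cst.
    rewrite -(normr0 R) -(subrr (u x)); apply: cvg_norm.
    by apply: cvgB; [exact: Hu|exact: cvg_cst].
  apply: (cvgr_to_ge cv).
  apply: filterS2 H1 (HS _ e0) => w [_ w1] Sw.
  have := le_trans Sw (power_tail lfG c_ge1 p_gt1 mu_gt0 mu_le (c_coercive m) m0 w1).
  rewrite lee_fin -lerBlDr => h; rewrite (le_trans _ (le_trans h _))//; first lra.
  apply: le_psum => x _; apply: powR_lip => //.
  exact: (energy_bound lfG c_ge1 mu_gt0 mu_le).
have Eu : Espace G c u.
  apply: Espace_closed => //; first by apply: le_lt_trans u1 _; exact: ltry.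
  move=> e e0.
  (* m and d make each of the two errors kappa / m and (p + 1) d of
     close_maximizers at most e S / 8 *)
  pose m := 8 * kappa p mu / (e * S) + 1.
  have eS : 0 < e * S by rewrite mulr_gt0.
  have m0 : 0 < m by rewrite ltr_pwDr// divr_ge0 ?mulr_ge0 ?kappa_ge0// ltW.
  pose d := e * S / (8 * (p + 1)).
  have d0 : 0 < d by rewrite divr_gt0// mulr_gt0.
  have Hd : \forall w \near H, psum G (D m) (pw u) - d <= psum G (D m) (dpw u w).
    have cv : psum G (D m) (dpw u w) @[w --> H] --> psum G (D m) (dpw u u).
      by apply: psum_cvg => x; apply: cvgM; [exact: cvg_cst|exact: Hu].
    have -> : psum G (D m) (pw u) = psum G (D m) (dpw u u).
      by apply: eq_psum => x _; rewrite /dpw powR_sqr.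
    by apply: (cvgr_ge _ cv); rewrite ltrBlDr ltrDl.
  have [w [[Ew w1] wd]] := filter_ex (filterI H1 Hd).
  exists w => //.
  apply: (@fatou_vsum _ _ G _ H _ (fun w2 => edens G c (w \- w2))).
  - move=> x; apply: (edens_cvg (h := fun w2 => w \- w2)) => z.
    by apply: cvgB; [exact: cvg_cst|exact: Hu].
  - by move=> w2 x; exact: edens_ge0.
  apply: filterS2 H1 Hd => w2 [Ew2 w21] w2d.
  have := close_maximizers Ew Ew2 w1 w21 (Spsum _ m0) wd w2d.
  move=> /le_trans; apply; rewrite lee_fin ler_pdivrMr//.
  have -> : (p + 1) * d = e * S / 8.
    by rewrite /d; field; rewrite gt_eqF.
  have : kappa p mu / m <= e * S / 8.
    rewrite ler_pdivrMr// /m mulrDr.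
    have -> : e * S / 8 * (8 * kappa p mu / (e * S)) = kappa p mu.
      by field; rewrite !gt_eqF.
    by rewrite lerDl mulr1 divr_ge0// ltW.
  by lra.
exists u; split=> //; apply/eqP; rewrite eq_le S_ub//=.
apply/lee_addgt0Pr => e e0.
pose m := kappa p mu / e + 1.
have m0 : 0 < m by rewrite ltr_pwDr// divr_ge0 ?kappa_ge0// ltW.
have km : kappa p mu / m <= e.
  rewrite ler_pdivrMr// /m mulrDr mulr1 mulrCA divff ?gt_eqF// mulr1.
  by rewrite lerDl ltW.
have := Spsum _ m0; rewrite -lee_fin => h.
rewrite -leeBlDr//; apply: le_trans (psum_le_vsum G (D m) _); last first.
  by move=> x; exact: powR_ge0.
apply: le_trans h; rewrite -EFinB lee_fin; lra.
Qed.

End Attained.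

(** * The Euler-Lagrange equation *)

(** This is ln f <= f - 1. *)
Lemma powR_le_expR (R : realType) (f b : R) : 0 <= f -> 0 <= b ->
  f `^ b <= expR (b * (f - 1)).
Proof.
move=> f0 b0; move: f0; rewrite le_eqVlt => /predU1P[<-|f0].
  move: b0; rewrite le_eqVlt => /predU1P[<-|b0].
    by rewrite powRr0 mul0r expR0.
  by rewrite powR0 ?expR_ge0// gt_eqF.
rewrite /powR gt_eqF// ler_expR ler_wpM2l//.
by rewrite -{1}(subrKC 1 f) le_ln1Dx// ltrBrDr addrC subrr.
Qed.

(** The two sides are equal at s = 0 and the inequality holds for both signs
    of s, so their slopes at 0 agree.  The power f^beta is first replaced by
    the larger expR (beta (f - 1)), which has the same value and slope at
    s = 0 and is differentiable for all s. *)
Lemma first_order_condition (R : realType) (beta b q r : R) : 0 < beta ->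
  (forall s, 0 <= 1 + 2 * s * q + s ^+ 2 * r) ->
  (forall s, 1 + 2 * beta * s * b <= (1 + 2 * s * q + s ^+ 2 * r) `^ beta) ->
  b = q.
Proof.
move=> beta0 f0 H.
pose g (s : R) := expR (beta * (2 * s * q + s ^+ 2 * r)) - 2 * beta * s * b.
have g_min s : g 0 <= g s.
  rewrite /g expr0n /= !(mulr0, mul0r) addr0 mulr0 expR0 subr0 lerBrDr.
  rewrite (le_trans (H s))// (le_trans (powR_le_expR (f0 s) (ltW beta0)))//.
  by rewrite ler_expR le_eqVlt (_ : _ - 1 = 2 * s * q + s ^+ 2 * r) ?eqxx//; ring.
have dg (x : R) : is_derive x 1 g
   (expR (beta * (2 * x * q + x ^+ 2 * r)) * (beta * (2 * q + 2 * x * r))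
    - 2 * beta * b).
  rewrite /g; apply: is_derive_eq.
  by rewrite /GRing.scale /=; ring.
have h0 : is_derive (0 : R) 1 g 0.
  apply: (@derive1_at_min _ _ (-1) 1) => //.
  by rewrite in_itv /=; lra.
have : expR (beta * (2 * 0 * q + 0 ^+ 2 * r)) * (beta * (2 * q + 2 * 0 * r))
    - 2 * beta * b = 0.
  have := @derive_val _ _ _ _ _ _ _ (dg 0).
  by rewrite (@derive_val _ _ _ _ _ _ _ h0).
have -> : beta * (2 * 0 * q + 0 ^+ 2 * r) = 0 by ring.
rewrite expR0 => e; have : (2 * beta) * (q - b) = 0 by rewrite -e; ring.
move=> /eqP; rewrite mulf_eq0 subr_eq0 => /orP[|/eqP->//].
by rewrite mulf_eq0 pnatr_eq0 /= gt_eqF.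
Qed.

Section EulerLagrange.
Context {R : realType} {V : choiceType} (G : wgraph R V).
Hypothesis lfG : locally_finite G.
Implicit Types (u v w phi : V -> R) (x : V) (s t e : R).
Variable c : V -> R.
Hypothesis c_ge1 : forall x, 1 <= c x.
Variable p : R.
Hypothesis p_gt1 : 1 < p.

Let c0 x : 0 <= c x. Proof. exact: le_trans ler01 (c_ge1 x). Qed.
Let p_gt0 : 0 < p. Proof. exact: lt_trans p_gt1. Qed.
Let p1_gt0 : 0 < p + 1. Proof. by rewrite addr_gt0. Qed.

Lemma energy_perturb u phi s (A : R) (D : {fset V}) :
  (forall x, x \notin D -> phi x = 0) ->
  (forall v x, x \notin D -> Gamma G v phi x = 0) ->
  energy G c u = A%:E ->
  energy G c (lin 1 s u phi) =
    (A + 2 * s * psum G D (bform G c u phi) + s ^+ 2 * psum G D (edens G c phi))%:E.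
Proof.
move=> p0 g0; have E0 := @edens_ge0 _ _ G lfG c c0.
rewrite /energy (@vsum_split _ _ G D (edens G c u))//.
rewrite (@vsum_split _ _ G D (edens G c (lin _ _ _ _)))//.
have -> : off D (edens G c (lin 1 s u phi)) = off D (edens G c u).
  apply/funext => x; rewrite /off; case: ifPn => // xD.
  rewrite edens_lin// /bform {2}/edens /grad2 !g0// p0//; ring.
have : (0 <= vsum G (off D (edens G c u)))%E.
  by apply: vsum_ge0 => x; rewrite /off; case: ifP.
case: (vsum _ _) => [r _|//|//].
rewrite -EFinD => -[<-]; rewrite -EFinD; congr EFin.
suff -> : psum G D (edens G c (lin 1 s u phi)) = psum G D (edens G c u) +
    2 * s * psum G D (bform G c u phi) + s ^+ 2 * psum G D (edens G c phi).
  by ring.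
by rewrite -!psumZ -!psumD; apply: eq_psum => x _; rewrite edens_lin//; ring.
Qed.

(** Only a lower bound, of first order in s: the tangent inequality on D,
    and no change outside. *)
Lemma power_perturb u phi s (A : R) (D : {fset V}) :
  (forall x, x \notin D -> phi x = 0) ->
  power G p u = A%:E ->
  ((A + (p + 1) * s * psum G D (fun x => `|u x| `^ (p - 1) * u x * phi x))%:E
   <= power G p (lin 1 s u phi))%E.
Proof.
move=> p0; have P0 v x : 0 <= `|v x| `^ (p + 1) by exact: powR_ge0.
rewrite /power (@vsum_split _ _ G D _ (P0 u)).
rewrite (@vsum_split _ _ G D _ (P0 (lin 1 s u phi))).
set r1 := off D _; set r2 := off D _.
have -> : r2 = r1.
  apply/funext => x; rewrite /r1 /r2 /off; case: ifPn => // xD.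
  by rewrite /lin p0// mulr0 addr0 mul1r.
have : (0 <= vsum G r1)%E by apply: vsum_ge0 => x; rewrite /r1 /off; case: ifP.
case: (vsum _ _) => [r _|//|//].
rewrite -EFinD => -[<-]; rewrite -EFinD lee_fin addrAC lerD2r.
rewrite -psumZ -psumD; apply: le_psum => x _.
have := powR_tangent p_gt1 (u x) (lin 1 s u phi x).
have -> : `|u x| `^ (p - 1) * u x * lin 1 s u phi x = `|u x| `^ (p + 1) +
    s * (`|u x| `^ (p - 1) * u x * phi x).
  by rewrite -(powR_sqr p_gt1) /lin; ring.
lra.
Qed.

(** The Lagrange multiplier of the normalised problem is S. *)
Lemma euler_lagrange (S : R) u phi (D : {fset V}) : 0 < S ->
  (forall w, Espace G c w -> (energy G c w <= 1)%E -> (power G p w <= S%:E)%E) ->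
  Espace G c u -> energy G c u = 1%E -> power G p u = S%:E ->
  Cc phi ->
  (forall x, x \notin D -> phi x = 0) ->
  (forall v x, x \notin D -> Gamma G v phi x = 0) ->
  psum G D (fun x => `|u x| `^ (p - 1) * u x * phi x) =
  S * psum G D (bform G c u phi).
Proof.
move=> S0 HS Eu u1 uS phiC p0 g0.
set b := psum G D _; set q := psum G D _; pose r := psum G D (edens G c phi).
have Es s : Espace G c (lin 1 s u phi).
  by apply: Espace_lin => //; exact: Cc_Espace.
have es s := energy_perturb s p0 g0 u1.
have f0 s : 0 <= 1 + 2 * s * q + s ^+ 2 * r.
  by rewrite -lee_fin -es energy_ge0.
have -> : S * q = S * (b / S); last by rewrite mulrC divfK// gt_eqF.
congr (_ * _); apply/esym.
apply: (@first_order_condition _ ((p + 1) / 2) _ _ r) => // [|s].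
  by rewrite divr_gt0.
have := le_trans (power_perturb s p0 uS)
  (power_homogeneous lfG c_ge1 p_gt1 (f0 s) HS (Es s) (es s)).
rewrite lee_fin -/b => h; rewrite -(ler_pM2l S0); apply: le_trans h.
by rewrite le_eqVlt; apply/orP; left; apply/eqP; field; rewrite gt_eqF.
Qed.

End EulerLagrange.

(** * Balls are finite *)

Section Balls.
Context {R : realType} {V : choiceType} (G : wgraph R V).
Hypothesis lfG : locally_finite G.
Hypothesis connG : connected_graph G.

(** The vertices joined to x0 by a walk of n + 1 edges are neighbours of those
    joined to it by a walk of n edges. *)
Lemma joined_in_finite (x0 : V) n : finite_set [set x | joined_in G x x0 n].
Proof.
elim: n => [|n IHn].
  apply: (@sub_finite_set _ _ [set x0]) => // x [s [_ + /eqP]].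
  by rewrite size_eq0 => /[swap] /eqP -> /= ->.
apply: (@sub_finite_set _ _
  (\bigcup_(y in [set y | joined_in G y x0 n]) [set x | edge G y x])).
  move=> x [[|y s] [//= /andP[xy ys] lasts [sizes]]].
  by exists y; [exists s|rewrite /= edge_sym].
by apply: bigcup_finite => // y _; exact: lfG.
Qed.

(** In a connected graph the distance is never a default value. *)
Lemma joined_in_dist (x y : V) : joined_in G x y (dist G x y).
Proof.
suff : exists n, joined_in G x y n /\ forall m, joined_in G x y m -> (n <= m)%N.
  by move=> /(xgetPex 0%N) [].
have [s xs ys] := connG x y.
have ex : exists n, `[< joined_in G x y n >].
  by exists (size s); apply/asboolP; exists s.
case: (ex_minnP ex) => n /asboolP xyn nmin.
by exists n; split => // m xym; apply: nmin; exact/asboolP.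
Qed.

Lemma ball_finite (x0 : V) N : finite_set [set x | (dist G x x0 < N)%N].
Proof.
apply: (@sub_finite_set _ _ (\bigcup_(n in `I_N) [set x | joined_in G x x0 n])).
  by move=> x xN; exists (dist G x x0) => //; exact: joined_in_dist.
by apply: bigcup_finite => // n _; exact: joined_in_finite.
Qed.

Lemma sublevel_finite (a : V -> R) (m : R) :
  (exists x0 : V, forall M : R, exists N : nat,
     forall x : V, (N <= dist G x x0)%N -> M <= a x) ->
  finite_set [set x | a x < m].
Proof.
move=> [x0 /(_ m)[N aN]]; apply: sub_finite_set (ball_finite x0 N) => x /=.
by move=> axm; rewrite ltnNge; apply/negP => /aN; rewrite leNgt axm.
Qed.

End Balls.

(** * Ground states *)

Section Bridge.
Context {R : realType} {V : choiceType} (G : wgraph R V).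
Hypothesis lfG : locally_finite G.
Variables (a : V -> R) (lambda p : R).
Hypothesis a_ge0 : forall x, 0 <= a x.
Hypothesis lambda_ge0 : 0 <= lambda.
Implicit Types u v w : V -> R.

Let c x := lambda * a x + 1.
Let la0 x : 0 <= lambda * a x. Proof. exact: mulr_ge0. Qed.
Let c0 x : 0 <= c x. Proof. by rewrite addr_ge0. Qed.

Lemma E_norm_sqr u : (E_norm G a lambda u ^+ 2)%E = energy G c u.
Proof.
rewrite /E_norm integralV_ge0; last exact: (edens_ge0 lfG c0).
by rewrite poweR12_sqrt ?sqr_sqrte//; exact: (energy_ge0 lfG c0).
Qed.

Lemma integral_power u : integralV G (fun x => `|u x| `^ (p + 1)) = power G p u.
Proof. by rewrite integralV_ge0// => x; exact: powR_ge0. Qed.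

Lemma W12_energy_fin u : W12 G u -> (energy G (cst 1%R) u < +oo)%E.
Proof.
move=> /(W12P lfG) /(_ 1 ltr01)[phi phiC phiu].
have -> : u = lin 1 (- 1) phi (phi \- u).
  by apply/funext => x; rewrite /lin /=; ring.
apply: energy_lin_fin => //; first exact: Cc_energy_fin.
by apply: le_lt_trans phiu _; exact: ltry.
Qed.

Lemma energy_split u : energy G c u = (energy G (cst 1%R) u +
  integralV G (fun x => lambda * a x * u x ^+ 2)%R)%E.
Proof.
have t0 x : 0 <= lambda * a x * u x ^+ 2 by rewrite mulr_ge0 ?sqr_ge0.
rewrite integralV_ge0// /energy -vsumD//; last exact: edens_ge0.
by apply: eq_vsum => x; rewrite /edens /c /=; ring.
Qed.

Lemma E_spaceE u : E_space G a lambda u <-> Espace G c u.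
Proof.
split=> -[Wu fu]; split => //.
  by rewrite energy_split lte_add_pinfty// W12_energy_fin.
apply: le_lt_trans fu; rewrite energy_split leeDr//; exact: energy_ge0.
Qed.

Lemma NehariP u : Nehari G a lambda p u <->
  [/\ Espace G c u, u != cst 0 & energy G c u = power G p u].
Proof.
by rewrite /Nehari /mkset E_norm_sqr integral_power; split=> -[/E_spaceE].
Qed.

(** On the Nehari manifold the two integrals in J coincide. *)
Lemma J_Nehari u (Y : R) : Nehari G a lambda p u -> energy G c u = Y%:E ->
  J G a lambda p u = ((2^-1 - (p + 1)^-1) * Y)%:E.
Proof.
move=> /NehariP[_ _ eu] uY.
by rewrite /J E_norm_sqr integral_power -eu uY -!EFinM -EFinB mulrBl.
Qed.

Lemma weak_solutionP u : Espace G c u ->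
  (forall (D : {fset V}) phi, Cc phi ->
    (forall x, x \notin D -> phi x = 0) ->
    (forall v x, x \notin D -> Gamma G v phi x = 0) ->
    psum G D (bform G c u phi) =
    psum G D (fun x => `|u x| `^ (p - 1) * u x * phi x)) ->
  weak_solution G a lambda p u.
Proof.
move=> Eu H; split; first exact/E_spaceE.
move=> phi phiC; have [D [p0 g0]] := Cc_nbhd lfG phiC.
rewrite !(@integralV_finsupp _ _ _ D).
- by congr EFin; exact: H.
- by move=> x xD; rewrite p0// mulr0.
- by move=> x xD; rewrite p0// g0// mulr0 addr0.
Qed.

End Bridge.

(** Dividing by Y leaves 1 <= S Y^((p-1)/2), where the right-hand side is
    increasing in Y and equal to 1 at Y = t^2. *)
Lemma nehari_lower_bound (R : realType) (p S t Y : R) : 1 < p -> 0 < S -> 0 <= t ->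
  t `^ (p - 1) * S = 1 -> 0 < Y -> Y <= S * Y `^ ((p + 1) / 2) ->
  t ^+ 2 <= Y.
Proof.
move=> p1 S0 t0 tS Y0 YS; rewrite leNgt; apply/negP => Yt.
have e0 : 0 < (p - 1) / 2 by rewrite divr_gt0// subr_gt0.
have := gt0_ltr_powR e0 (ltW Y0 : Y \in Num.nneg) (sqr_ge0 t : _ \in Num.nneg) Yt.
rewrite -powR_mulrn// -powRrM (_ : 2%:R * ((p - 1) / 2) = p - 1); last by field.
rewrite -(ltr_pM2r S0) tS => h.
have := YS; rewrite (_ : (p + 1) / 2 = 1 + (p - 1) / 2); last by field.
rewrite powRD; last by apply/implyP => _; rewrite gt_eqF.
rewrite (powRr1 (ltW Y0)) mulrCA ler_pMr// leNgt mulrC => /negP; exact.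
Qed.

Theorem theorem1p1 (R : realType) (V : choiceType) (G : wgraph R V)
  (lfG : locally_finite G) (connG : connected_graph G)
  (symG : symmetric_weight G) (posG : uniformly_positive G)
  (p : R) (p_ge2 : 2 <= p)
  (a : V -> R) (a_ge0 : forall x, 0 <= a x)
  (Omega_neq0 : [set x | a x = 0] !=set0)
  (Omega_conn : connected_domain G [set x | a x = 0])
  (Omega_bnd : bounded_domain G [set x | a x = 0])
  (a_infty : exists x0 : V, forall M : R, exists N : nat,
     forall x : V, (N <= dist G x x0)%N -> M <= a x)
  (lambda : R) (lambda_gt1 : 1 < lambda) :
  exists u : V -> R, ground_state G a lambda p u.
Proof.
have [mu mu0 muG] := posG; have [x0 _] := Omega_neq0.
have p1 : 1 < p by lra.
have l0 : 0 <= lambda by lra.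
pose c x := lambda * a x + 1.
have c1 x : 1 <= c x by rewrite lerDr mulr_ge0.
have c0 x : 0 <= c x by rewrite (le_trans ler01).
have cfin m : finite_set [set x | c x < m].
  apply: sub_finite_set (sublevel_finite lfG connG m a_infty) => x /=.
  apply: le_lt_trans; rewrite /c -[X in X <= _]mul1r.
  by rewrite (le_trans (ler_wpM2r (a_ge0 x) (ltW lambda_gt1)))// lerDl.
have [S S0 [Sub Sapp]] := best_constant lfG c1 p1 mu0 muG x0.
have [u [Eu u1 uS]] := best_constant_attained lfG c1 cfin p1 mu0 muG S0 Sub Sapp.
(* if the energy were A < 1, then power u <= S A < S *)
have {u1} u1 : energy G c u = 1%E.
  apply/eqP; rewrite eq_le u1/=.
  have [A A0 uA] := energy_fin lfG c0 Eu.2.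
  move: u1; rewrite uA !lee_fin => A1.
  have := power_le_energy lfG c1 p1 S0 Sub Eu uA A1.
  by rewrite uS !lee_fin ler_pMr.
(* the multiple of u that lies on the Nehari manifold *)
pose t := S `^ (- (p - 1)^-1).
have pm0 : p - 1 != 0 by rewrite gt_eqF// subr_gt0.
have t0 : 0 < t by exact: powR_gt0.
have tS : t `^ (p - 1) * S = 1.
  by rewrite /t -powRrM mulNr mulVf// powR_inv1 ?ltW// mulVf// gt_eqF.
pose v x := t * u x.
have Ev : Espace G c v by exact: Espace_scale.
have ev : energy G c v = (t ^+ 2)%:E by rewrite energy_scale// u1 mule1.
have pv : power G p v = (t ^+ 2)%:E.
  rewrite power_scale ?(ltW t0)// uS -EFinM; congr EFin.
  rewrite (_ : p + 1 = 2%:R + (p - 1)); last by ring.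
  rewrite powRD; last by apply/implyP => _; rewrite gt_eqF.
  by rewrite powR_mulrn ?ltW// -mulrA tS mulr1.
have vN : Nehari G a lambda p v.
  apply/NehariP => //; split => //; last by rewrite ev pv.
  apply/eqP => v0; have : (0 < energy G c v)%E by rewrite ev lte_fin exprn_gt0.
  have -> : v = (fun x => 0 * v x) by rewrite v0; apply/funext => x; rewrite mul0r.
  by rewrite energy_scale// expr0n mul0e ltxx.
exists v; split => //.
- apply: weak_solutionP => // D phi phiC p0 g0.
  have := euler_lagrange lfG c1 p1 S0 Sub Eu u1 uS phiC p0 g0.
  set b := psum _ _ _ => bE.
  have -> : psum G D (bform G c v phi) = t * psum G D (bform G c u phi).
    by rewrite -psumZ; apply: eq_psum => x _; rewrite bform_scale.
  have -> : psum G D (fun x => `|v x| `^ (p - 1) * v x * phi x) =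
      t `^ (p - 1) * t * b.
    rewrite -psumZ; apply: eq_psum => x _.
    by rewrite /v normrM powRM// (ger0_norm (ltW t0)); ring.
  by rewrite bE mulrACA tS mul1r.
- apply/eqP; rewrite eq_le; apply/andP; split; last first.
    by apply: ereal_inf_lbound; exists v.
  apply: le_ereal_inf_tmp => _ [w wN <-].
  have [Ew w0 ew] := (NehariP lfG p a_ge0 l0 w).1 wN.
  have [Y Y0 wY] := energy_fin lfG c0 Ew.2.
  rewrite (J_Nehari lfG a_ge0 l0 vN ev) (J_Nehari lfG a_ge0 l0 wN wY) lee_fin.
  apply: ler_wpM2l.
    by rewrite subr_ge0 lef_pV2 ?posrE; lra.
  apply: (nehari_lower_bound p1 S0 (ltW t0) tS).
    rewrite lt0r Y0 andbT; apply: contra w0 => /eqP Y00.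
    by apply/eqP/funext => x; apply: (energy_eq0 lfG c1); rewrite wY Y00.
  have := power_homogeneous lfG c1 p1 Y0 Sub Ew wY.
  by rewrite -ew wY lee_fin.
Qed.
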